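(* Let $(z,\lambda)\in\Omega_{\mathcal{E}}\times\mathbb{R}^p_+$ be a KKT pair up to $\mathcal{E}$ of (RMP). If $(\varphi,g)$ is $\theta$-pseudo-quasi generalized convex on $S$ at $z$, then $z$ is an almost $\mathcal{E}$-quasi Pareto solution of (RMP).
   Context: Setting. $\mathbb{R}^n$ carries the Euclidean norm $\|\cdot\|$; $\mathbb{B}$ is its closed unit ball and $B(x,\rho)$ the open ball. $I=\{1,\ldots,m\}$, $J=\{1,\ldots,p\}$. $\mathcal{K}_c$ is the set of closed bounded intervals $[a^L,a^U]$, $a^L\le a^U$. $S\subset\mathbb{R}^n$ is nonempty and closed. For $i\in I$, $f_i(x)=[f_i^L(x),f_i^U(x)]\in\mathcal{K}_c$, where $f_i^L,f_i^U:\mathbb{R}^n\to\mathbb{R}$ are locally Lipschitz with $f_i^L(x)\le f_i^U(x)$. For $j\in J$, $\mathcal{V}_j\subset\mathbb{R}^{n_j}$ is nonempty compact and $g_j:\mathbb{R}^n\times\mathbb{R}^{n_j}\to\mathbb{R}$. Put $g_j(x):=\max_{v_j\in\mathcal{V}_j}g_j(x,v_j)$, $\mathcal{V}_j(x):=\{v_j\in\mathcal{V}_j: g_j(x,v_j)=g_j(x)\}$, $g:=(g_1,\ldots,g_p)$ and $\varphi(x):=\sum_{i\in I}[f_i^L(x)+f_i^U(x)]$. Standing conditions on $g_j$: for every $\bar x\in\mathbb{R}^n$ and $j\in J$ there is $\delta>0$ such that (a) $v_j\in\mathcal{V}_j\mapsto g_j(x,v_j)$ is upper semicontinuous for each $x\in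 B(\bar x,\delta)$, and the functions $g_j(\cdot,v_j)$, $v_j\in\mathcal{V}_j$, are Lipschitz on $B(\bar x,\delta)$ with a common constant $K_j$; (b) the multifunction $(x,v_j)\in B(\bar x,\delta)\times\mathcal{V}_j\rightrightarrows\partial_x g_j(x,v_j)$ is closed at $(\bar x,\bar v_j)$ for each $\bar v_j\in\mathcal{V}_j(\bar x)$ (i.e. if $(x^k,v^k)\to(\bar x,\bar v_j)$, $x_k^*\in\partial_x g_j(x^k,v^k)$, $x_k^*\to x^*$, then $x^*\in\partial_x g_j(\bar x,\bar v_j)$). $N(x;S)$ is the limiting (Mordukhovich) normal cone to $S$ at $x$; $\partial$ is the limiting (Mordukhovich) subdifferential, $\partial_x$ the limiting subdifferential in the variable $x$; $\mathrm{co}$ denotes convex hull; $C^\circ:=\{x^*:\langle x^*,x\rangle\le0\ \forall x\in C\}$ is the polar cone. Fix reals $0\le\epsilon_i^L\le\epsilon_i^U$, $i\in I$, with $\theta:=\sum_{i\in I}(\epsilon_i^L+\epsilon_i^U)>0$. Put $\mathcal{E}_i:=[\epsilon_i^L,\epsilon_i^U]$, $\mathcal{E}:=(\mathcal{E}_1,\ldots,\mathcal{E}_m)$. (RMP) is the problem of minimizing $(f_1,\ldots,f_m)$ with respect to the order below over $\Omega:=\{x\in S: g_j(x,v_j)\le0\ \forall v_j\in\mathcal{V}_j,\ \forall j\in J\}=\{x\in S: g_j(x)\le 0,\ j\in J\}$. Put $\Omega_{\mathcal{E}}:=\{x\in S: g_j(x)\le\sqrt{\theta},\ j\in J\}$.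 Intervals: $[a^L,a^U]-[b^L,b^U]=[a^L-b^U,a^U-b^L]$; $k[a^L,a^U]=[ka^L,ka^U]$ for $k\ge0$; $A\le_{LU}B$ iff $a^L\le b^L$ and $a^U\le b^U$; $A<_{LU}B$ iff $A\le_{LU}B$ and $A\ne B$. A point $\bar x\in\Omega_{\mathcal{E}}$ is an almost $\mathcal{E}$-quasi Pareto solution of (RMP) if there is no $x\in\Omega$ with $f_i(x)\le_{LU}f_i(\bar x)-\frac{\mathcal{E}_i}{\sqrt\theta}\|x-\bar x\|$ for all $i\in I$ and $f_k(x)<_{LU}f_k(\bar x)-\frac{\mathcal{E}_k}{\sqrt\theta}\|x-\bar x\|$ for at least one $k\in I$. A pair $(z,\lambda)\in\Omega_{\mathcal{E}}\times\mathbb{R}^p_+$ is a KKT pair up to $\mathcal{E}$ of (RMP) if $0\in\sum_{i\in I}[\partial f_i^L(z)+\partial f_i^U(z)]+\sum_{j\in J}\lambda_j\,\mathrm{co}\{\partial_x g_j(z,v_j): v_j\in\mathcal{V}_j(z)\}+N(z;S)+\sqrt{\theta}\,\mathbb{B}$; $\lambda_j>0$ for all $j\in J$ with $0<g_j(z)\le\sqrt\theta$; and $\lambda_j=0$ if $g_j(z)\le0$. $(\varphi,g)$ is $\theta$-pseudo-quasi generalized convex on $S$ at $z\in S$ if for any $x\in S$, $z_i^{*L}\in\partial f_i^L(z)$, $z_i^{*U}\in\partial f_i^U(z)$, $i\in I$, and $x^*_{v_j}\in\partial_x g_j(z,v_j)$, $v_j\in\mathcal{V}_j(z)$, $j\in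 J$, there exists $\omega\in[N(z;S)]^\circ$ satisfying: $\sum_{i\in I}[\langle z_i^{*L},\omega\rangle+\langle z_i^{*U},\omega\rangle]+\sqrt\theta\|x-z\|\ge0\Rightarrow\varphi(x)\ge\varphi(z)-\sqrt\theta\|x-z\|$; $g_j(x,v_j)\le g_j(z,v_j)\Rightarrow\langle x^*_{v_j},\omega\rangle\le0$ for $v_j\in\mathcal{V}_j(z)$, $j\in J$; and $\langle b^*,\omega\rangle\le\|x-z\|$ for all $b^*\in\mathbb{B}$.
   Formalization: In the generalized convexity, one ω must serve any finite family of subgradients of each g_j(·,v_j) at active v_j, several allowed for the same v_j; with just one subgradient per v_j the claim fails, e.g. for g = c + min(x1,x2). *)

(* Defs.v *)
From HB Require Import structures.
From mathcomp Require Import all_boot all_order all_algebra.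
From mathcomp Require Import all_classical all_reals all_analysis.

Set Implicit Arguments.
Unset Strict Implicit.
Unset Printing Implicit Defensive.

Import Order.TTheory GRing.Theory Num.Theory.
Import numFieldNormedType.Exports.

Local Open Scope classical_set_scope.
Local Open Scope ring_scope.

(* The library norm on ['rV[R]_n] is the sup norm.  It is used here only through
   the topology it induces, which is the Euclidean one; every metric quantity
   goes through [enorm]. *)
Section Euclidean.
Context {R : realType} {n : nat}.
Implicit Types (x y u v : 'rV[R]_n) (A : set 'rV[R]_n).

Definition dot u v : R := \sum_(i < n) u ord0 i * v ord0 i.

Definition enorm u : R := Num.sqrt (dot u u).

Definition eball x (r : R) : set 'rV[R]_n := [set y | enorm (y - x) < r].

Definition eunit_ball : set 'rV[R]_n := [set b | enorm b <= 1].

Definition elipschitz_on (K : R) A (f : 'rV[R]_n -> R) : Prop :=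
  forall x y, A x -> A y -> `|f x - f y| <= K * enorm (x - y).

Definition locally_elipschitz (f : 'rV[R]_n -> R) : Prop :=
  forall x, exists2 r : R, 0 < r & exists K : R, elipschitz_on K (eball x r) f.

Definition polar A : set 'rV[R]_n :=
  [set w | forall x, A x -> dot w x <= 0].

Definition convex_hull A : set 'rV[R]_n :=
  smallest (@convex_set R 'rV[R]_n) A.

(* [limsup <v, u - x> / ||u - x|| <= 0] as [u] tends to [x] within [A],
   with the quotient multiplied out. *)
Definition frechet_normal A x : set 'rV[R]_n :=
  [set v | A x /\ forall e : R, 0 < e ->
     \forall u \near x, A u -> dot v (u - x) <= e * enorm (u - x)].

Definition limiting_normal A x : set 'rV[R]_n :=
  [set v | exists (xs vs : nat -> 'rV[R]_n),
     [/\ forall k, frechet_normal A (xs k) (vs k),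
         xs @ \oo --> x & vs @ \oo --> v]].

End Euclidean.

Section Subdifferential.
Context {R : realType} {n : nat}.
Implicit Types (f : 'rV[R]_n -> R) (x : 'rV[R]_n).

Definition epigraph f : set 'rV[R]_(n + 1) :=
  [set w | f (lsubmx w) <= rsubmx w ord0 ord0].

Definition limiting_subdiff f x : set 'rV[R]_n :=
  [set v | limiting_normal (epigraph f)
             (row_mx x (f x)%:M) (row_mx v (- 1)%:M)].

End Subdifferential.

(* [(aL, aU)] stands for the interval [aL, aU]; the inequality [aL <= aU] is a
   hypothesis wherever it matters, so that equality of intervals is equality
   of pairs. *)
Section Intervals.
Context {R : realType}.
Implicit Types (k : R) (a b : R * R).

Definition ival_sub a b : R * R := (a.1 - b.2, a.2 - b.1).
Definition ival_scale k a : R * R := (k * a.1, k * a.2).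
Definition le_LU a b : Prop := a.1 <= b.1 /\ a.2 <= b.2.
Definition lt_LU a b : Prop := le_LU a b /\ a <> b.

End Intervals.

Unset Implicit Arguments.

Record rmp_data (R : realType) (n m p : nat) := RmpData {
  rmp_S : set 'rV[R]_n;
  rmp_fL : 'I_m -> 'rV[R]_n -> R;
  rmp_fU : 'I_m -> 'rV[R]_n -> R;
  rmp_dim : 'I_p -> nat;
  rmp_V : forall j : 'I_p, set 'rV[R]_(rmp_dim j);
  rmp_g : forall j : 'I_p, 'rV[R]_n -> 'rV[R]_(rmp_dim j) -> R
}.

Arguments rmp_S {R n m p} r.
Arguments rmp_fL {R n m p} r i x.
Arguments rmp_fU {R n m p} r i x.
Arguments rmp_dim {R n m p} r j.
Arguments rmp_V {R n m p} r j.
Arguments rmp_g {R n m p} r j x v.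

Section RobustProblem.
Context {R : realType} {n m p : nat} (P : rmp_data R n m p).
Local Notation S := (rmp_S P).
Local Notation fL := (rmp_fL P).
Local Notation fU := (rmp_fU P).
Local Notation V := (rmp_V P).
Local Notation g := (rmp_g P).
Implicit Types (x z w : 'rV[R]_n) (E : 'I_m -> R * R) (theta : R).

Definition rmp_f (i : 'I_m) x : R * R := (fL i x, fU i x).

Definition rmp_phi x : R := \sum_(i < m) (fL i x + fU i x).

(* Under [rmp_standing] and compactness of [V j] this supremum is a maximum. *)
Definition rmp_gmax (j : 'I_p) x : R := sup [set g j x v | v in V j].

Definition rmp_Vmax (j : 'I_p) x : set 'rV[R]_(rmp_dim P j) :=
  [set v | V j v /\ g j x v = rmp_gmax j x].

Definition rmp_subdiff_g (j : 'I_p) x (v : 'rV[R]_(rmp_dim P j)) :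
    set 'rV[R]_n :=
  limiting_subdiff (fun y => g j y v) x.

Definition rmp_usc (j : 'I_p) x : Prop :=
  forall v, V j v -> forall a : R, g j x v < a ->
    \forall v' \near v, V j v' -> g j x v' < a.

Definition rmp_subdiff_closed (j : 'I_p) x (r : R)
    (v : 'rV[R]_(rmp_dim P j)) : Prop :=
  forall (xs : nat -> 'rV[R]_n) (vs : nat -> 'rV[R]_(rmp_dim P j))
         (us : nat -> 'rV[R]_n) (u : 'rV[R]_n),
    (forall k, eball x r (xs k)) -> (forall k, V j (vs k)) ->
    (forall k, rmp_subdiff_g j (xs k) (vs k) (us k)) ->
    xs @ \oo --> x -> vs @ \oo --> v -> us @ \oo --> u ->
    rmp_subdiff_g j x v u.

Definition rmp_standing : Prop :=
  forall x (j : 'I_p), exists2 r : R, 0 < r &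
    [/\ forall y, eball x r y -> rmp_usc j y,
        exists K : R, forall v, V j v ->
          elipschitz_on K (eball x r) (fun y => g j y v) &
        forall v, rmp_Vmax j x v -> rmp_subdiff_closed j x r v].

Definition rmp_feasible : set 'rV[R]_n :=
  [set x | S x /\ forall j v, V j v -> g j x v <= 0].

Definition rmp_theta E : R := \sum_(i < m) ((E i).1 + (E i).2).

Definition rmp_relaxed E : set 'rV[R]_n :=
  [set x | S x /\ forall j, rmp_gmax j x <= Num.sqrt (rmp_theta E)].

Definition rmp_almost_quasi_Pareto E : set 'rV[R]_n :=
  [set z | rmp_relaxed E z /\
    let target x i :=
      ival_sub (rmp_f i z)
        (ival_scale (enorm (x - z) / Num.sqrt (rmp_theta E)) (E i)) in
    ~ exists x, [/\ rmp_feasible x,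
        forall i, le_LU (rmp_f i x) (target x i) &
        exists k, lt_LU (rmp_f k x) (target x k)]].

(* The membership of 0 in the Minkowski sum, written with one summand from
   each of its terms. *)
Definition rmp_KKT E z (lam : 'I_p -> R) : Prop :=
  [/\ rmp_relaxed E z,
      forall j, 0 <= lam j,
      exists (zL zU : 'I_m -> 'rV[R]_n) (c : 'I_p -> 'rV[R]_n)
             (nu b : 'rV[R]_n),
        [/\ forall i, limiting_subdiff (fL i) z (zL i) /\
                      limiting_subdiff (fU i) z (zU i),
            forall j, convex_hull
              (\bigcup_(v in rmp_Vmax j z) rmp_subdiff_g j z v) (c j),
            limiting_normal S z nu,
            eunit_ball b &
            0 = \sum_(i < m) (zL i + zU i) + \sum_(j < p) lam j *: c j + nu
                + Num.sqrt (rmp_theta E) *: b],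
      forall j, 0 < rmp_gmax j z <= Num.sqrt (rmp_theta E) -> 0 < lam j &
      forall j, rmp_gmax j z <= 0 -> lam j = 0].

(* The vectors [xs j k] are any finitely many elements of the subdifferentials
   of [g j] at active parameters [v j k]; one active parameter may occur with
   several of its subgradients, as in an element of the convex hull used in
   [rmp_KKT].  This matters: these subdifferentials need not be convex. *)
Definition rmp_pseudo_quasi_convex theta z : Prop :=
  S z /\
  forall x, S x ->
  forall zL zU : 'I_m -> 'rV[R]_n,
    (forall i, limiting_subdiff (fL i) z (zL i)) ->
    (forall i, limiting_subdiff (fU i) z (zU i)) ->
  forall (K : 'I_p -> nat)
         (v : forall j, 'I_(K j) -> 'rV[R]_(rmp_dim P j))
         (xs : forall j, 'I_(K j) -> 'rV[R]_n),
    (forall j k, rmp_Vmax j z (v j k)) ->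
    (forall j k, rmp_subdiff_g j z (v j k) (xs j k)) ->
  exists w, polar (limiting_normal S z) w /\
    [/\ 0 <= \sum_(i < m) (dot (zL i) w + dot (zU i) w)
             + Num.sqrt theta * enorm (x - z) ->
        rmp_phi z - Num.sqrt theta * enorm (x - z) <= rmp_phi x,
        forall j k, g j x (v j k) <= g j z (v j k) -> dot (xs j k) w <= 0 &
        forall b, eunit_ball b -> dot b w <= enorm (x - z)].

End RobustProblem.

(* Main.v *)
Require Import Defs.
From HB Require Import structures.
From mathcomp Require Import all_boot all_order all_algebra.
From mathcomp Require Import all_classical all_reals all_analysis.

Import Order.TTheory GRing.Theory Num.Theory.
Import numFieldNormedType.Exports.

Local Open Scope classical_set_scope.
Local Open Scope ring_scope.

(** Suppose that a feasible [x] violates the conclusion.  Adding up the interval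
    inequalities, whose error terms [E i * ||x - z|| / sqrt theta] sum to
    [sqrt theta * ||x - z||], gives
    [phi x < phi z - sqrt theta * ||x - z||] ([rmp_phi_lt_of_dominates]).
    By the contrapositive of the pseudo-convexity clause, the direction [w]
    provided by the generalized convexity at [x] then satisfies
    [sum_i (<zL i, w> + <zU i, w>) + sqrt theta * ||x - z|| < 0].

    Pairing the KKT identity with [w] shows that the same quantity is
    nonnegative.  The normal [nu] contributes at most [0] because [w] lies in
    the polar of the normal cone, and the term [sqrt theta *: b] contributes at
    most [sqrt theta * ||x - z||].  A constraint with [lam j != 0] has
    [gmax j z > 0], whereas [g j x v <= 0] by feasibility; so every active
    subgradient has a nonpositive product with [w], and hence so does [c j].

    The order of choice is the delicate point: [w] depends on the subgradients,
    so they have to be extracted from the membership of [c j] in the convex hull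
    before [w] is known.  [convex_hull_finite_halfspace] does this. *)

Section DotProduct.
Context {R : realType} {n : nat}.
Implicit Types (u v w : 'rV[R]_n).

Lemma dotC u v : dot u v = dot v u.
Proof. by apply: eq_bigr => i _; rewrite mulrC. Qed.

Lemma dot0l w : dot 0 w = 0.
Proof. by apply: big1 => i _; rewrite mxE mul0r. Qed.

Lemma dotDl u v w : dot (u + v) w = dot u w + dot v w.
Proof. by rewrite -big_split; apply: eq_bigr => i _; rewrite mxE mulrDl. Qed.

Lemma dotZl (a : R) u w : dot (a *: u) w = a * dot u w.
Proof. by rewrite mulr_sumr; apply: eq_bigr => i _; rewrite mxE mulrA. Qed.

Lemma dot_suml (I : finType) (F : I -> 'rV[R]_n) w :
  dot (\sum_i F i) w = \sum_i dot (F i) w.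
Proof.
exact: (big_morph (dot^~ w) (fun u v => dotDl u v w) (dot0l w)).
Qed.

End DotProduct.

(** A point of the convex hull of [A] is a convex combination of finitely many
    points of [A], so a half-space [<_, w> <= 0] containing those points contains
    it.  This consequence is all that is used of the combination, and stating it
    without the weights makes the set of such [c] visibly convex:
    concatenate the two lists.  The list depends on [c] only, not on [w]. *)
Lemma convex_hull_finite_halfspace {R : realType} {n : nat}
    (A : set 'rV[R]_n) (c : 'rV[R]_n) :
  convex_hull A c ->
  exists s : seq 'rV[R]_n, (forall a, a \in s -> A a) /\
    forall w, (forall a, a \in s -> dot a w <= 0) -> dot c w <= 0.
Proof.
pose Q : set 'rV[R]_n := [set c | exists s : seq 'rV[R]_n,
  (forall a, a \in s -> A a) /\
  forall w, (forall a, a \in s -> dot a w <= 0) -> dot c w <= 0].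
move=> /(_ Q); apply; split.
- move=> x y t; rewrite !inE => -[s [As sx]] [s' [As' s'y]].
  exists (s ++ s'); split=> [a|w ws].
    by rewrite mem_cat => /orP[/As|/As'].
  have xw : dot x w <= 0 by apply: sx => a sa; apply: ws; rewrite mem_cat sa.
  have yw : dot y w <= 0.
    by apply: s'y => a sa; apply: ws; rewrite mem_cat sa orbT.
  rewrite /conv/= dotDl !dotZl.
  by apply: ler_wnDl; rewrite mulr_ge0_le0 // unstable.onem_ge0.
- move=> x Ax; exists [:: x]; split=> [a|w ws].
    by rewrite inE => /eqP ->.
  by apply: ws; rewrite inE.
Qed.

(** Each side of the domination loses [(E i).2] or [(E i).1] times
    [||x - z|| / sqrt theta]; over all sides the loss is
    [theta * ||x - z|| / sqrt theta].  The strictness comes from the index at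
    which the two intervals differ. *)
Lemma rmp_phi_lt_of_dominates {R : realType} {n m p : nat}
    (P : rmp_data R n m p) (E : 'I_m -> R * R) (x z : 'rV[R]_n) :
  let target i := ival_sub (rmp_f P i z)
    (ival_scale (enorm (x - z) / Num.sqrt (rmp_theta E)) (E i)) in
  0 < rmp_theta E ->
  (forall i, le_LU (rmp_f P i x) (target i)) ->
  (exists k, lt_LU (rmp_f P k x) (target k)) ->
  rmp_phi P x < rmp_phi P z - Num.sqrt (rmp_theta E) * enorm (x - z).
Proof.
move=> target th0 le_all [k [_ neq_k]].
have target_sum : rmp_phi P z - Num.sqrt (rmp_theta E) * enorm (x - z) =
    \sum_(i < m) ((target i).1 + (target i).2).
  set d := enorm (x - z); set q := Num.sqrt (rmp_theta E).
  have q0 : q != 0 by rewrite sqrtr_eq0 -ltNge.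
  have -> : q * d = d / q * rmp_theta E.
    by rewrite -(sqr_sqrtr (ltW th0)) -/q expr2 mulrA divfK// mulrC.
  rewrite /rmp_phi /rmp_theta mulr_sumr -sumrB; apply: eq_bigr => i _ /=.
  by rewrite addrACA -opprD -mulrDr [(E i).2 + _]addrC.
rewrite target_sum /rmp_phi (bigD1 k)//= [ltRHS](bigD1 k)//=.
apply: ltr_leD; last first.
  by apply: ler_sum => i _; have [] := le_all i; exact: lerD.
have [le1 le2] := le_all k.
rewrite lt_neqAle lerD// andbT; apply: contra_notN neq_k => /eqP eq12.
(* two termwise inequalities with equal sums are equalities *)
have eq1 : (rmp_f P k x).1 = (target k).1.
  apply/eqP; rewrite eq_le le1 -(lerD2r (rmp_fU P k x)) /= eq12.
  by rewrite lerD2l.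
rewrite [LHS]surjective_pairing [RHS]surjective_pairing eq1; congr pair.
by move: eq12; rewrite -[rmp_fL P k x]/((rmp_f P k x).1) eq1 => /addrI.
Qed.

Theorem theorem3p3 (R : realType) (n m p : nat) (P : rmp_data R n m p)
    (E : 'I_m -> R * R) (z : 'rV[R]_n) (lam : 'I_p -> R)
    (hS0 : rmp_S P !=set0) (hS : closed (rmp_S P))
    (hfL : forall i, locally_elipschitz (rmp_fL P i))
    (hfU : forall i, locally_elipschitz (rmp_fU P i))
    (hf : forall i x, rmp_fL P i x <= rmp_fU P i x)
    (hV0 : forall j, rmp_V P j !=set0) (hV : forall j, compact (rmp_V P j))
    (hg : rmp_standing P)
    (hE : forall i, 0 <= (E i).1 <= (E i).2)
    (htheta : 0 < rmp_theta E)
    (hKKT : rmp_KKT P E z lam)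
    (hconv : rmp_pseudo_quasi_convex P (rmp_theta E) z) :
  rmp_almost_quasi_Pareto P E z.
Proof.
have [zE lam0 [zL [zU [c [nu [b [hz hc hnu hb kkt]]]]]] _ lam_inact] := hKKT.
split=> // target -[x [[Sx gx] le_all lt_some]].
have phi_lt := rmp_phi_lt_of_dominates _ _ _ _ htheta le_all lt_some.
have /choice[s hs] := fun j => convex_hull_finite_halfspace _ _ (hc j).
pose xs j (k : 'I_(size (s j))) : 'rV[R]_n := (s j)`_k.
have active j k : exists v,
    rmp_Vmax P j z v /\ rmp_subdiff_g P j z v (xs j k).
  have [|v Vv gv] := (hs j).1 (xs j k); first exact: mem_nth.
  by exists v.
pose v j k := projT1 (cid (active j k)).
have hv j k : rmp_Vmax P j z (v j k) /\ rmp_subdiff_g P j z (v j k) (xs j k).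
  exact: (projT2 (cid (active j k))).
have [_ hw] := hconv.
have [w [w_polar [w_phi w_g w_ball]]] := hw x Sx zL zU
  (fun i => (hz i).1) (fun i => (hz i).2) _ v xs
  (fun j k => (hv j k).1) (fun j k => (hv j k).2).
have constr_le0 : \sum_(j < p) lam j * dot (c j) w <= 0.
  apply: sumr_le0 => j _.
  have [/lam_inact ->|gmax_gt0] := leP (rmp_gmax P j z) 0.
    by rewrite mul0r.
  apply: mulr_ge0_le0 => //; apply: (hs j).2 => a /(nthP 0)[k ks <-].
  apply: (w_g j (Ordinal ks)).
  have [[Vv ->] _] := hv j (Ordinal ks).
  exact: le_trans (gx j _ Vv) (ltW gmax_gt0).
have nu_le0 : dot nu w <= 0 by rewrite dotC; exact: w_polar.
have b_le : Num.sqrt (rmp_theta E) * dot b w <=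
    Num.sqrt (rmp_theta E) * enorm (x - z).
  by apply: ler_wpM2l; [exact: sqrtr_ge0 | exact: w_ball].
move: phi_lt; rewrite ltNge => /negP; apply; apply: w_phi.
have := congr1 (dot^~ w) kkt.
rewrite dot0l !dotDl !dot_suml dotZl.
under eq_bigr do rewrite dotDl.
under [X in _ + X + _ + _]eq_bigr do rewrite dotZl.
move=> eq0; rewrite [leLHS]eq0; apply: lerD => //.
by apply: ler_wnDr => //; apply: ler_wnDr.
Qed.
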